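(* Consider the partially observed discrete time stochastic hybrid system, safe set $K$, horizon $N$, initial density $\rho$, operator $T_{u,y}$, information-state policies $\overline\Pi$ and cost $\overline r_K$ described in the context. Define functions $V_k^*$ of the information state by the dynamic programming equations $$V_N^*(\sigma)=\langle\sigma,{\bf 1}_K\rangle,\qquad V_k^*(\sigma)=\sup_{u\in\mathcal U}\mathbb E^{\dag}\big[V_{k+1}^*(T_{u,y_{k+1}}[\sigma])\big],\quad k=N-1,\dots,0,$$ where $$\mathbb E^{\dag}\big[V(T_{u,y_{k+1}}[\sigma])\big]=\sum_{y^q\in\mathcal Q}\int_{\mathbb R^n}V(T_{u,(y^x,y^q)}[\sigma])\,\tfrac1{N_q}\phi(y^x)\,dy^x .$$ Then $V_0^*(\rho)=\sup_{\overline\pi\in\overline\Pi}\overline r_K(\overline\pi)$, where $V_k^*:\Sigma_k\to[0,\infty)$, and for normalized $\sigma$ (i.e. $\sum_q\int\sigma(x,q)\,dx=1$) the values $V_k^*(\sigma)$ lie in $[0,1]$. Furthermore, setting $$\overline\mu_k^*(\sigma)=\arg\sup_{u\in\mathcal U}\mathbb E^{\dag}\big[V_{k+1}^*(T_{u,y_{k+1}}[\sigma])\big]$$ for all $k=0,\dots,N-1$ gives the optimal policy $\overline\pi^*=(\overline\mu_0^*,\dots,\overline\mu_{N-1}^* )$, $\overline\mu_k^*:\Sigma_k\to\mathcal U$, i.e. $\overline r_K(\overline\pi^* )=\sup_{\overline\pi\in\overline\Pi}\overline r_K(\overline\pi)$.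
   Context: System. $\mathcal Q$ is a finite set of discrete states with $N_q$ elements, $X\subseteq\mathbb R^n$ is the set of continuous states, $\mathcal S=X\times\mathcal Q$ is the hybrid state space with states $s=(x,q)$ (integrals over the continuous state are written over $\mathbb R^n$), and $\mathcal U$ is a compact Borel space of control inputs. The state transition law is $\tau(ds'\mid s,u)=T_x(dx'\mid x,u,q')\,T_q(q'\mid x,q,u)$, where $T_x$ is a Borel-measurable stochastic kernel and $T_q$ a discrete transition kernel; $\tau(x',q'\mid x,q,u)$ denotes the corresponding transition density (with respect to Lebesgue measure in $x'$ times counting measure in $q'$). The initial state $s_0$ has Borel-measurable density $\rho$ on $\mathcal S$. Observations. At times $k\ge1$ one observes $y_k=(y_k^x,y_k^q)\in\mathbb R^n\times\mathcal Q$, conditionally independent given the state, with $y_k^x=h(x_k,u_{k-1})+v_k$, where $h$ is bounded and continuous and the $v_k$ are i.i.d. with positive density $\phi$ on $\mathbb R^n$, and $P[y_k^q=m\mid q_k=q,u_{k-1}=u]=Q_{q,m}(u)$, assumed nowhere zero. Safe set: $K\subseteq\mathcal S$ is Borel, and $N$ is the finite time horizon. For $\sigma\in L^1(\mathcal S)$, $\langle\sigma,{\bf 1}_K\rangle=\sum_{q\in\mathcal Q}\int_{\mathbb R^n}\sigma(x,q){\bf 1}_K(x,q)\,dx$. Operator. For $u\in\mathcal U$, $y=(y^x,y^q)$ and $\sigma\in L^1(\mathcal S)$, $$T_{u,y}[\sigma](x,q)=\sum_{q^-\in\mathcal Q}N_qQ_{q,y^q}(u)\int_{\mathbb R^n}{\bf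 1}_K(x^-,q^-)\frac{\phi(y^x-h(x,u))}{\phi(y^x)}\tau(x,q\mid x^-,q^-,u)\sigma(x^-,q^-)\,dx^- .$$ Information states and policies. $\Sigma_k$ is the space of information states at time $k$ (nonnegative functions in $L^1(\mathcal S)$, interpreted as unnormalized densities). A policy $\overline\pi=(\overline\mu_0,\dots,\overline\mu_{N-1})\in\overline\Pi$ consists of (non-randomized) functions $\overline\mu_k:\Sigma_k\to\mathcal U$. Under the measure $\mathbb P^{\dag}$ (expectation $\mathbb E^{\dag}$), the $y_k$ are i.i.d. with $y_k^x$ of density $\phi$, $y_k^q$ uniform on $\mathcal Q$, and $y_k^x,y_k^q$ independent. Under $\overline\pi$ the information state evolves as $\sigma_0=\rho$, $u_k=\overline\mu_k(\sigma_k)$, $\sigma_{k+1}=T_{u_k,y_{k+1}}[\sigma_k]$, and the cost (to be maximized) is $\overline r_K(\overline\pi)=\mathbb E^{\dag}[\langle\sigma_N,{\bf 1}_K\rangle]$.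
   Formalization: The optimality claim covers every policy whose components attain the suprema; without continuity in u the arg sup can be empty, so its existence is not asserted. Expectations for non-measurable policies are iterated inner integrals; Q_{q,m}(u) and τ are taken Borel measurable. *)

(* Defs.v *)
From HB Require Import structures.
From mathcomp Require Import all_boot all_order all_algebra.
From mathcomp Require Import all_classical all_reals all_analysis.
From mathcomp Require Import measurable_realfun.

Set Implicit Arguments.
Unset Strict Implicit.
Unset Printing Implicit Defensive.

Import Order.TTheory GRing.Theory Num.Theory.
Import numFieldNormedType.Exports.

Local Open Scope classical_set_scope.
Local Open Scope ring_scope.
Local Open Scope ereal_scope.

HB.instance Definition _ (R : realType) (m n : nat) :=
  @isMeasurable.Build (sigma_display (@open 'M[R]_(m, n))) 'M[R]_(m, n)
    <<s @open 'M[R]_(m, n) >> (@sigma_algebra0 _ _ _) (@sigma_algebraC _ _)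
    (@sigma_algebra_bigcup _ _ _).

Section rV.
Context (R : realType) (n : nat).

Lemma rV_open_measurable (A : set 'rV[R]_n) : open A -> measurable A.
Proof. exact: sub_sigma_algebra. Qed.

Lemma measurable_rVP d (T : measurableType d) (f : T -> 'rV[R]_n) :
  (forall i, measurable_fun setT (fun t => f t ord0 i : measurableTypeR R)) ->
  measurable_fun setT f.
Proof.
move=> mf.
apply: (@measurability _ _ _ _ setT f (@open 'rV[R]_n)) => //.
move=> _ [A oA <-]; rewrite setTI.
pose c (p : 'rV[rat]_n * nat) : 'rV[R]_n := map_mx ratr p.1.
pose r (p : 'rV[rat]_n * nat) : R := (p.2.+1%:R^-1)%R.
have r0 p : (0 < r p)%R by rewrite invr_gt0.
have -> : A = \bigcup_(p in [set p | ball (c p) (r p) `<=` A]) ball (c p) (r p).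
  apply/seteqP; split=> [x Ax|x [p pA xp]]; last exact: pA.
  have /nbhs_ballP[e /= e0 xeA] := open_nbhs_nbhs (conj oA Ax).
  have [k ke] : exists k : nat, (k.+1%:R^-1 < e / 2)%R.
    exists (Num.truncn (e / 2)^-1).
    by rewrite invf_plt ?posrE ?divr_gt0// truncnS_gt.
  pose k0 : R := (k.+1%:R^-1)%R.
  have k00 : (0 < k0)%R by rewrite invr_gt0.
  have /choice[q hq] : forall i, exists q : rat, (x ord0 i - k0 < ratr q < x ord0 i + k0)%R.
    move=> i; have [|q] := @rat_in_itvoo R (x ord0 i - k0)%R (x ord0 i + k0)%R.
      by rewrite ltrD2l gtrN.
    by rewrite in_itv/=; exists q.
  have xb : ball (c (\row_i q i, k)) k0 x.
    split=> // i j; rewrite /c !mxE /ball/= (ord1 i).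
    by rewrite ltr_distl; exact: hq.
  exists (\row_i q i, k) => //= y yb; apply: xeA.
  apply: (@le_ball _ _ _ (k0 + k0)%R).
    by rewrite (splitr e) lerD// ltW.
  by apply: (@ball_triangle _ _ (c (\row_i q i, k))) => //; exact: ball_sym.
rewrite preimage_bigcup bigcup_mkcond.
apply: countable_bigcupT_measurable => // p; case: ifPn => // _.
have -> : f @^-1` ball (c p) (r p) =
    \big[setI/setT]_(i < n) ((fun t => f t ord0 i) @^-1` ball (c p ord0 i) (r p)).
  apply/seteqP; split=> [t [_ tb]|t]; first by rewrite -bigcap_seq => i _; exact: tb.
  rewrite -bigcap_seq => tb; split=> // i j; rewrite (ord1 i).
  by apply: tb; rewrite /= mem_index_enum.
apply: bigsetI_measurable => i _; rewrite -[X in measurable X]setTI.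
by apply: mf => //; apply: open_measurable; exact: ball_open.
Qed.

Lemma measurable_coord (i : 'I_n) :
  measurable_fun setT (fun v : 'rV[R]_n => v ord0 i : measurableTypeR R).
Proof.
apply: (@measurability _ _ _ _ setT _ _ (RGenOInfty.measurableE R)) => //.
move=> _ [_ [a ->] <-]; rewrite setTI; apply: rV_open_measurable.
apply: open_comp; last exact: interval_open.
by move=> v _; exact: coord_continuous.
Qed.
End rV.

Lemma sigma_finite_pushforward d1 d2 (T1 : measurableType d1)
    (T2 : measurableType d2) (R : realType)
    (mu : {measure set T1 -> \bar R}) (f : T1 -> T2) (g : T2 -> T1) :
  sigma_finite setT mu -> measurable_fun setT g -> cancel f g ->
  sigma_finite setT (pushforward mu f).
Proof.
move=> [F TF Foo] mg fK.
exists (fun k => g @^-1` F k).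
  by rewrite -preimage_bigcup -TF preimage_setT.
move=> k; have [mF muF] := Foo k; split.
  by rewrite -[X in measurable X]setTI; exact: mg.
rewrite /pushforward (_ : _ @^-1` _ = F k)//.
by apply/seteqP; split=> x /=; rewrite fK.
Qed.

Lemma sigma_finite_product d1 d2 (T1 : measurableType d1)
    (T2 : measurableType d2) (R : realType)
    (m1 : {sigma_finite_measure set T1 -> \bar R})
    (m2 : {sigma_finite_measure set T2 -> \bar R}) : sigma_finite setT (m1 \x m2).
Proof.
have /sigma_finiteP[F [TF ndF Foo]] := sigma_finiteT m1.
have /sigma_finiteP[G [TG ndG Goo]] := sigma_finiteT m2.
exists (fun n => F n `*` G n).
  rewrite -setXTT TF TG predeqE => -[x y]; split.
    move=> [/= [n _ Fnx] [k _ Gky]]; exists (maxn n k) => //; split.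
    - by move: x Fnx; exact/subsetPset/ndF/leq_maxl.
    - by move: y Gky; exact/subsetPset/ndG/leq_maxr.
  by move=> [n _ []/= ? ?]; split; exists n.
move=> k; have [? ?] := Foo k; have [? ?] := Goo k.
split; first exact: measurableX.
by rewrite product_measure1E// lte_mul_pinfty// ge0_fin_numE.
Qed.

Section cons_measure.
Context d (T : measurableType d) (R : realType) (n : nat).
Variables (mu : {sigma_finite_measure set T -> \bar R})
          (nu : {sigma_finite_measure set (n.-tuple T) -> \bar R}).

Definition tcons (p : T * n.-tuple T) : n.+1.-tuple T := [tuple of p.1 :: p.2].

Lemma measurable_tcons : measurable_fun setT tcons.
Proof. exact: measurable_cons. Qed.

Definition cons_measure : set (n.+1.-tuple T) -> \bar R :=
  pushforward (mu \x nu) tcons.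


Let m0 : cons_measure set0 = 0.
Proof. by rewrite /cons_measure /pushforward preimage_set0 measure0. Qed.

Let mge0 A : 0 <= cons_measure A.
Proof. by rewrite /cons_measure /pushforward measure_ge0. Qed.

Let madd : semi_sigma_additive cons_measure.
Proof.
exact: (@measure_semi_sigma_additive _ _ _
  (measure_function_pushforward__canonical__measure_function_Measure (mu \x nu) measurable_tcons)).
Qed.

HB.instance Definition _ := isMeasure.Build _ _ _ cons_measure m0 mge0 madd.

Let msf : sigma_finite setT cons_measure.
Proof.
apply: (@sigma_finite_pushforward _ _ _ _ R (mu \x nu) tcons
  (fun t : n.+1.-tuple T => (thead t, [tuple of behead t]))).
- exact: sigma_finite_product.
- by apply/measurable_fun_pairP; split;
    [exact: measurable_tnth|exact: measurable_behead].
- by move=> [x t]; rewrite theadE; congr pair; apply: val_inj.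
Qed.

HB.instance Definition _ := Measure_isSigmaFinite.Build _ _ _ cons_measure msf.

End cons_measure.

Fixpoint tuple_measure d (T : measurableType d) (R : realType)
    (mu : {sigma_finite_measure set T -> \bar R}) (n : nat) :
    {sigma_finite_measure set (n.-tuple T) -> \bar R} :=
  match n with
  | 0 => \d_ [tuple]
  | n'.+1 => cons_measure mu (tuple_measure mu n')
  end.

Lemma integral_tuple_measureS d (T : measurableType d) (R : realType)
    (mu : {sigma_finite_measure set T -> \bar R}) (n : nat)
    (f : n.+1.-tuple T -> \bar R) :
  measurable_fun setT f -> (forall t, 0 <= f t) ->
  \int[tuple_measure mu n.+1]_t f t =
  \int[mu]_x \int[tuple_measure mu n]_t f (tcons (x, t)).
Proof.
move=> mf f0; transitivity (\int[mu \x tuple_measure mu n]_p f (tcons p)).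
  rewrite [LHS](ge0_integral_pushforward (measurable_tcons (n := n)))//.
rewrite fubini_tonelli1//; apply: (measurableT_comp mf).
exact: measurable_tcons.
Qed.

(* Lebesgue measure on R^n: the image of the n-fold product measure. *)
Section lebesgue_rV.
Context (R : realType) (n : nat).

Definition rV_of_tuple (t : n.-tuple (measurableTypeR R)) : 'rV[R]_n :=
  \row_i tnth t i.

Definition lebesgue_rV : set 'rV[R]_n -> \bar R :=
  pushforward (tuple_measure lebesgue_measure n) rV_of_tuple.

Let measurable_rV_of_tuple : measurable_fun setT rV_of_tuple.
Proof.
apply: measurable_rVP => i.
rewrite (_ : (fun _ => _) = (fun t => tnth t i)); first exact: measurable_tnth.
by apply/funext => t; rewrite mxE.
Qed.

Let m0 : lebesgue_rV set0 = 0.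
Proof. by rewrite /lebesgue_rV /pushforward preimage_set0 measure0. Qed.

Let mge0 A : 0 <= lebesgue_rV A.
Proof. by rewrite /lebesgue_rV /pushforward measure_ge0. Qed.

Let madd : semi_sigma_additive lebesgue_rV.
Proof.
exact: (@measure_semi_sigma_additive _ _ _
  (measure_function_pushforward__canonical__measure_function_Measure
     (tuple_measure lebesgue_measure n) measurable_rV_of_tuple)).
Qed.

HB.instance Definition _ := isMeasure.Build _ _ _ lebesgue_rV m0 mge0 madd.

Let msf : sigma_finite setT lebesgue_rV.
Proof.
apply: (@sigma_finite_pushforward _ _ _ _ _ (tuple_measure lebesgue_measure n)
  rV_of_tuple (fun v : 'rV[R]_n => [tuple v ord0 i | i < n])).
- exact: sigma_finiteT.
- apply/measurable_fun_tnthP => i.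
  rewrite (_ : _ \o _ = (fun v : 'rV[R]_n => v ord0 i)).
    exact: measurable_coord.
  by apply/funext => v /=; rewrite tnth_mktuple.
- by move=> t; apply: eq_from_tnth => i; rewrite tnth_mktuple mxE.
Qed.

HB.instance Definition _ := Measure_isSigmaFinite.Build _ _ _ lebesgue_rV msf.

End lebesgue_rV.

(* The Borel sigma-algebra of U; a compact Hausdorff pseudometric space is a
   compact metrizable, hence compact Borel, space. *)
Notation borel U := (g_sigma_algebraType (@open U)).

(* Densities on X * Q are represented by functions on R^n * Q that vanish
   off X; Q carries the counting measure, so that measurability in the
   discrete component is stated mode by mode.  Fields that involve a
   current state only constrain states of X. *)
Record poshs (R : realType) (n : nat) (Q : finType) (U : pseudoPMetricType R) :=
  POSHS {
  X : set 'rV[R]_n ;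
  Tx : Q -> R.-pker ('rV[R]_n * borel U) ~> 'rV[R]_n ;  (* T_x(dx' | x, u, q') *)
  Tq : Q -> 'rV[R]_n -> Q -> U -> R ;                   (* T_q(q' | x, q, u) *)
  tau : 'rV[R]_n -> Q -> 'rV[R]_n -> Q -> U -> R ;      (* tau(x', q' | x, q, u) *)
  rho : 'rV[R]_n * Q -> R ;
  h : 'rV[R]_n -> U -> 'rV[R]_n ;
  phi : 'rV[R]_n -> R ;
  Qobs : Q -> Q -> U -> R ;                             (* Q_{q,m}(u) *)
  K : set ('rV[R]_n * Q) ;
  X_measurable : measurable X ;
  Tq_ge0 : forall q' x q u, X x -> (0 <= Tq q' x q u)%R ;
  Tq_sum1 : forall x q u, X x -> (\sum_(q' : Q) Tq q' x q u = 1)%R ;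
  Tq_measurable : forall q' q, measurable_fun (X `*` [set: borel U])
    (fun p : 'rV[R]_n * borel U => Tq q' p.1 q p.2) ;
  tau_ge0 : forall x' q' x q u, X x -> (0 <= tau x' q' x q u)%R ;
  tau_measurable : forall q' q,
    measurable_fun ([set: 'rV[R]_n] `*` (X `*` [set: borel U]))
      (fun p : 'rV[R]_n * ('rV[R]_n * borel U) => tau p.1 q' p.2.1 q p.2.2) ;
  tau_supp : forall x' q' x q u, X x -> ~ X x' -> tau x' q' x q u = 0%R ;
  tau_density : forall q' x q u (A : set 'rV[R]_n), X x -> measurable A ->
    \int[@lebesgue_rV R n]_(x' in A) (tau x' q' x q u)%:E =
    Tx q' (x, u) A * (Tq q' x q u)%:E ;
  rho_ge0 : forall s, (0 <= rho s)%R ;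
  rho_measurable : forall q, measurable_fun setT (fun x => rho (x, q)) ;
  rho_supp : forall x q, ~ X x -> rho (x, q) = 0%R ;
  rho_mass : \sum_(q : Q) \int[@lebesgue_rV R n]_x (rho (x, q))%:E = 1 ;
  h_bounded : exists M : R, forall x u, X x -> (`|h x u| <= M)%R ;
  h_continuous :
    {within X `*` [set: U], continuous (fun p : 'rV[R]_n * U => h p.1 p.2)} ;
  phi_gt0 : forall y, (0 < phi y)%R ;
  phi_measurable : measurable_fun setT phi ;
  phi_mass : \int[@lebesgue_rV R n]_y (phi y)%:E = 1 ;
  Qobs_gt0 : forall q m u, (0 < Qobs q m u)%R ;
  Qobs_sum1 : forall q u, (\sum_(m : Q) Qobs q m u = 1)%R ;
  Qobs_measurable : forall q m,
    measurable_fun setT (fun u : borel U => Qobs q m u) ;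
  K_measurable : forall q, measurable [set x | K (x, q)] ;
  K_sub : forall x q, K (x, q) -> X x }.

Section poshs_defs.
Context (R : realType) (n : nat) (Q : finType) (U : pseudoPMetricType R).
Variable H : poshs n Q U.

Notation leb := (@lebesgue_rV R n).
Notation obs := ('rV[R]_n * Q)%type.

(* Unnormalized densities are extended-real-valued: Top u y sigma, and its
   mass, may be infinite for exceptional x and y, which form null sets. *)
Definition istate := 'rV[R]_n * Q -> \bar R.

Definition mass (sigma : istate) : \bar R :=
  \sum_(q : Q) \int[leb]_x sigma (x, q).

(* The nonnegative elements of L^1(X * Q). *)
Definition Sigma : set istate := [set sigma : istate |
  [/\ forall s, 0 <= sigma s,
      forall q, measurable_fun setT (fun x => sigma (x, q)),
      forall x q, ~ X H x -> sigma (x, q) = 0 &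
      mass sigma < +oo]].

(* <sigma, 1_K> *)
Definition safe_mass (sigma : istate) : \bar R :=
  \sum_(q : Q) \int[leb]_x (sigma (x, q) * (\1_(K H) (x, q))%:E).

Definition Top (u : U) (y : obs) (sigma : istate) : istate := fun s =>
  \sum_(q' : Q) ((#|Q|%:R * Qobs H s.2 y.2 u)%:E *
    \int[leb]_x' ((\1_(K H) (x', q') *
                   (phi H (y.1 - h H s.1 u) / phi H y.1) *
                   tau H s.1 s.2 x' q' u)%:E * sigma (x', q'))).

(* Expectation under P^dagger of a function of a single observation.  As for
   every integral of a nonnegative function in the library, no measurability
   is required of V: the integral is then the inner (lower) integral. *)
Definition Eobs (V : obs -> \bar R) : \bar R :=
  \sum_(q : Q) \int[leb]_y (V (y, q) * (#|Q|%:R^-1 * phi H y)%:E).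

(* Expectation under P^dagger of a function of N i.i.d. observations, taken
   one observation at a time so that it makes sense for arbitrary policies;
   by Tonelli's theorem it is the integral against the joint density for
   measurable functions, see EdagE. *)
Fixpoint Edag (N : nat) (f : seq obs -> \bar R) : \bar R :=
  match N with
  | 0 => f [::]
  | N'.+1 => Eobs (fun y => Edag N' (fun ys => f (y :: ys)))
  end.

(* mu_k is only ever meaningful on Sigma; its values elsewhere are irrelevant
   as the run of a policy stays in Sigma almost surely. *)
Definition policy (N : nat) := N.-tuple (istate -> U).

Fixpoint run (pi : seq (istate -> U)) (ys : seq obs) (sigma : istate) : istate :=
  match pi, ys with
  | mu :: pi', y :: ys' => run pi' ys' (Top (mu sigma) y sigma)
  | _, _ => sigma
  end.

Definition sigma0 : istate := fun s => (rho H s)%:E.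

Definition cost (N : nat) (pi : policy N) : \bar R :=
  Edag N (fun ys => safe_mass (run pi ys sigma0)).

Fixpoint Vtogo (j : nat) (sigma : istate) : \bar R :=
  match j with
  | 0 => safe_mass sigma
  | j'.+1 => ereal_sup [set Eobs (fun y => Vtogo j' (Top u y sigma)) | u in [set: U]]
  end.

Definition Vstar (N k : nat) : istate -> \bar R := Vtogo (N - k).

Definition argsup_policy (N : nat) (pi : policy N) : Prop :=
  forall (k : 'I_N) (sigma : istate), Sigma sigma ->
    Eobs (fun y => Vstar N k.+1 (Top (tnth pi k sigma) y sigma)) =
    ereal_sup [set Eobs (fun y => Vstar N k.+1 (Top u y sigma)) | u in [set: U]].

Lemma EdagE (N : nat) (f : seq obs -> \bar R) :
  (forall ys, 0 <= f ys) ->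
  (forall qs : N.-tuple Q,
    measurable_fun setT (fun v : N.-tuple 'rV[R]_n => f (zip v qs))) ->
  Edag N f = \sum_(qs : N.-tuple Q) \int[tuple_measure leb N]_v
    (f (zip v qs) * (\prod_(i < N) (#|Q|%:R^-1 * phi H (tnth v i)))%R%:E).
Proof.
elim: N f => [|N IH] f f0 mf.
  rewrite (big_pred1 [tuple]); last by move=> qs; apply/esym/eqP/tuple0.
  rewrite /= integral_dirac//; last first.
    apply: emeasurable_funM; first exact: (mf [tuple]).
    by under eq_fun do rewrite big_ord0; exact: measurable_cst.
  by rewrite diracT mul1e big_ord0 mule1.
have w0 y : (0 <= #|Q|%:R^-1 * phi H y)%R.
  by rewrite mulr_ge0// ltW// phi_gt0.
have mw M : measurable_fun setT (fun v : M.-tuple 'rV[R]_n =>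
    (\prod_(i < M) (#|Q|%:R^-1 * phi H (tnth v i)))%R).
  apply: measurable_prod => i _; apply: measurable_funM => //.
  apply: (measurableT_comp (phi_measurable H)); exact: measurable_tnth.
have mg (qs : N.+1.-tuple Q) : measurable_fun setT (fun v : N.+1.-tuple 'rV[R]_n =>
    f (zip v qs) * (\prod_(i < N.+1) (#|Q|%:R^-1 * phi H (tnth v i)))%R%:E).
  by apply: emeasurable_funM; [exact: mf|apply/measurable_EFinP; exact: mw].
have g0 (qs : N.+1.-tuple Q) (v : N.+1.-tuple 'rV[R]_n) :
  0 <= f (zip v qs) * (\prod_(i < N.+1) (#|Q|%:R^-1 * phi H (tnth v i)))%R%:E.
  by rewrite mule_ge0// lee_fin prodr_ge0.
have step (q : Q) (qs : N.-tuple Q) :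
  \int[tuple_measure leb N.+1]_v (f (zip v (q :: qs)) *
     (\prod_(i < N.+1) (#|Q|%:R^-1 * phi H (tnth v i)))%R%:E) =
  \int[leb]_y \int[tuple_measure leb N]_v
     (f ((y, q) :: zip v qs) * (\prod_(i < N) (#|Q|%:R^-1 * phi H (tnth v i)))%R%:E
      * (#|Q|%:R^-1 * phi H y)%:E).
  rewrite integral_tuple_measureS; last 2 first.
  - exact: (mg [tuple of q :: qs]).
  - exact: (g0 [tuple of q :: qs]).
  apply: eq_integral => y _; apply: eq_integral => v _ /=.
  rewrite -muleA -EFinM big_ord_recl/= mulrC tnth0.
  by under eq_bigr do rewrite tnthS.
pose F (qs : N.-tuple Q) (q : Q) (y : 'rV[R]_n) : \bar R :=
  \int[tuple_measure leb N]_v (f ((y, q) :: zip v qs) *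
    (\prod_(i < N) (#|Q|%:R^-1 * phi H (tnth v i)))%R%:E).
have mfy (q : Q) (qs : N.-tuple Q) :
    measurable_fun setT (fun p : 'rV[R]_n * N.-tuple 'rV[R]_n =>
      f ((p.1, q) :: zip p.2 qs) *
      (\prod_(i < N) (#|Q|%:R^-1 * phi H (tnth p.2 i)))%R%:E).
  apply: emeasurable_funM.
    exact: (measurableT_comp (mf [tuple of q :: qs]) (measurable_tcons (n := N))).
  by apply/measurable_EFinP; apply: (measurableT_comp (mw N)); exact: measurable_snd.
have h0 q (qs : N.-tuple Q) y (v : N.-tuple 'rV[R]_n) :
  0 <= f ((y, q) :: zip v qs) * (\prod_(i < N) (#|Q|%:R^-1 * phi H (tnth v i)))%R%:E.
  by rewrite mule_ge0// lee_fin prodr_ge0.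
have mF q qs : measurable_fun setT (F qs q).
  exact: (measurable_fun_fubini_tonelli_F _ (mfy q qs)).
rewrite (reindex (fun p : Q * N.-tuple Q => [tuple of p.1 :: p.2])) /=; last first.
  exists (fun t : N.+1.-tuple Q => (thead t, [tuple of behead t])) => [[q t] _|t _].
    by rewrite theadE; congr pair; apply: val_inj.
  by rewrite -tuple_eta.
rewrite -(pair_bigA _ (fun (q : Q) (qs : N.-tuple Q) =>
  \int[tuple_measure leb N.+1]_v (f (zip v (q :: qs)) *
     (\prod_(i < N.+1) (#|Q|%:R^-1 * phi H (tnth v i)))%R%:E)))/=.
apply: eq_bigr => q _.
under eq_bigr do rewrite step.
transitivity (\int[leb]_y \sum_(qs : N.-tuple Q)
    (F qs q y * (#|Q|%:R^-1 * phi H y)%:E)).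
  apply: eq_integral => y _; rewrite IH//; last first.
    move=> qs; exact: (measurableT_comp (mf [tuple of q :: qs])
      (measurableT_comp (measurable_tcons (n := N)) (pair1_measurable y))).
  by rewrite ge0_sume_distrl// => qs _; apply: integral_ge0 => v _; exact: h0.
rewrite ge0_integral_sum//; last 2 first.
- move=> qs; apply: emeasurable_funM => //; apply/measurable_EFinP.
  by apply: measurable_funM => //; exact: phi_measurable.
- move=> qs y _; rewrite mule_ge0// ?lee_fin//.
  by apply: integral_ge0 => v _; exact: h0.
apply: eq_bigr => qs _; apply: eq_integral => y _.
have mfq := measurableT_comp (mfy q qs) (pair1_measurable y).
by rewrite (ge0_integralZr _ measurableT mfq)// ?lee_fin// => v _; exact: h0.
Qed.

End poshs_defs.

(* Main.v *)
Require Import Defs.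
From HB Require Import structures.
From mathcomp Require Import all_boot all_order all_algebra.
From mathcomp Require Import all_classical all_reals all_analysis.
From mathcomp Require Import measurable_realfun ring.
Import Order.TTheory GRing.Theory Num.Theory.
Import numFieldNormedType.Exports HBNNSimple.
Local Open Scope classical_set_scope.
Local Open Scope ring_scope.
Local Open Scope ereal_scope.
Set Implicit Arguments.
Unset Strict Implicit.
Unset Printing Implicit Defensive.

(* Because integrals of non-measurable functions are lower integrals, neither
   the value functions nor the policies have to be measurable: what is needed is
   monotonicity, and [lower f <= lower g + integral b] when [f <= g + b] with [b]
   measurable.  Up to the weight [N_q / phi y] cancelled by the observation
   density, [Top] is a prediction step through [tau] followed by multiplication
   by [Qobs * phi (y - h)]; Tonelli and translation invariance of Lebesgue measure
   then give [E (mass (Top u y sigma)) = safe_mass sigma <= mass sigma].  Hence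
   [V_k <= mass], and a policy that maximizes each stage up to [e * mass sigma]
   loses at most [N e] overall, the errors being averaged by the same identity. *)

(** * Lower integrals of functions that need not be measurable *)

Section lower_integral.
Context d (T : measurableType d) (R : realType).
Variable mu : {measure set T -> \bar R}.

Lemma ge0_le_lower_integral (f g : T -> \bar R) :
  (forall x, 0 <= f x) -> (forall x, f x <= g x) ->
  \int[mu]_x f x <= \int[mu]_x g x.
Proof.
move=> f0 fg.
have g0 x : 0 <= g x by exact: le_trans (fg x).
rewrite !ge0_integralTE//; apply: le_ereal_sup => _ [s sf <-].
by exists s => // x; exact: le_trans (fg x).
Qed.

(** Lower integrals are in general only superadditive; measurability of [b] rescues the other
    direction. For a simple [s] below [f], the positive part of [s - b] is measurable and below [g],
    and adding [b] back dominates [s]. *)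
Lemma ge0_lower_integral_leD (f g b : T -> \bar R) :
  (forall x, 0 <= f x) -> (forall x, 0 <= g x) -> (forall x, 0 <= b x) ->
  measurable_fun setT b -> (forall x, f x <= g x + b x) ->
  \int[mu]_x f x <= \int[mu]_x g x + \int[mu]_x b x.
Proof.
move=> f0 g0 b0 mb fgb.
rewrite [leLHS]ge0_integralTE//; apply: ge_ereal_sup => _ [s sf <-].
rewrite -integralT_nnsfun.
pose k x := maxe ((s x)%:E - b x) 0.
have k0 x : 0 <= k x by rewrite le_max lexx orbT.
have mk : measurable_fun setT k.
  apply: measurable_maxe => //; apply: emeasurable_funB => //.
  exact/measurable_EFinP.
have kg x : k x <= g x.
  rewrite ge_max g0 andbT.
  have := sf x; move: (fgb x) (b0 x) => /[swap] b0x /[swap] /le_trans /[apply].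
  case: (b x) b0x => [r| |]// _; last by rewrite addeNy leNye.
  by rewrite leeBlDr.
apply: (@le_trans _ _ (\int[mu]_x k x + \int[mu]_x b x)); last first.
  by rewrite leeD2r//; exact: ge0_le_lower_integral.
rewrite -ge0_integralD//; apply: ge0_le_lower_integral => x.
  by rewrite lee_fin; exact: fun_ge0.
have := b0 x; rewrite /k; case: (b x) => [r| |]// _.
  by rewrite -leeBlDr// le_max lexx.
by rewrite addey ?leey// gt_eqF// lt_max ltNy0 orbT.
Qed.

End lower_integral.

(** * Translation invariance of Lebesgue measure on [R], tuples and row vectors *)

Lemma ge0_integral_lebesgue_shift (R : realType) (f : measurableTypeR R -> \bar R)
    (c : R) :
  measurable_fun setT f -> (forall x, 0 <= f x) ->
  \int[lebesgue_measure]_x f (x - c)%R = \int[lebesgue_measure]_x f x.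
Proof.
move=> mf f0.
pose sh (x : measurableTypeR R) : measurableTypeR R := (x - c)%R.
have msh : measurable_fun setT sh by exact: measurable_funB.
pose m : {measure set (measurableTypeR R) -> \bar R} :=
  measure_function_pushforward__canonical__measure_function_Measure
    lebesgue_measure msh.
transitivity (\int[m]_x f x).
  by rewrite (ge0_integral_pushforward msh).
apply: (eq_measure_integral lebesgue_measure) => A mA _.
(* Lebesgue measure is determined by the half-open intervals, and a shift preserves their
   lengths. *)
apply/esym; apply: (@lebesgue_measure_unique _ m) => //.
move=> _ [[a b] _ <-] /=; rewrite /pushforward.
rewrite (_ : sh @^-1` _ = [set` `](a + c)%R, (b + c)%R]]); last first.
  by apply/seteqP; split=> x /=; rewrite !in_itv/= /sh ltrBrDr lerBlDr.
rewrite !lebesgue_measure_itv/= !lte_fin ltrD2r; case: ifP => // _.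
by rewrite -!EFinB opprD addrACA subrr addr0.
Qed.

(** Tonelli peels off one coordinate at a time. The shift is indexed by [nat], so that its tail in
    the induction is just [c \o S]. *)
Lemma ge0_integral_tuple_measure_shift (R : realType) (n : nat) (c : nat -> R)
    (f : n.-tuple (measurableTypeR R) -> \bar R) :
  measurable_fun setT f -> (forall t, 0 <= f t) ->
  \int[tuple_measure lebesgue_measure n]_t
     f [tuple (tnth t i - c i)%R | i < n] =
  \int[tuple_measure lebesgue_measure n]_t f t.
Proof.
elim: n c f => [|n IH] c f mf f0.
  by apply: eq_integral => t _; congr f; rewrite [LHS]tuple0 [RHS]tuple0.
have msh : measurable_fun setT (fun t : n.+1.-tuple (measurableTypeR R) =>
    [tuple (tnth t i - c i)%R | i < n.+1] : n.+1.-tuple (measurableTypeR R)).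
  apply/measurable_fun_tnthP => i.
  rewrite (_ : _ \o _ = (fun t => tnth t i - c i)%R).
    by apply: measurable_funB => //; exact: measurable_tnth.
  by apply/funext => t /=; rewrite tnth_mktuple.
rewrite integral_tuple_measureS; last 2 first.
- exact: (measurableT_comp mf msh).
- by move=> t; exact: f0.
rewrite [RHS]integral_tuple_measureS//.
have mft := measurableT_comp mf (measurable_tcons (n := n)).
pose F x := \int[tuple_measure lebesgue_measure n]_t f (tcons (x, t)).
have mF : measurable_fun setT F.
  apply: (measurable_fun_fubini_tonelli_F (f \o @tcons _ (measurableTypeR R) n)
    mft) => p.
  exact: f0.
transitivity (\int[lebesgue_measure]_x F (x - c 0)%R); last first.
  by rewrite ge0_integral_lebesgue_shift// => x; exact: integral_ge0.
apply: eq_integral => x _; rewrite /F.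
rewrite -(IH (c \o S) (fun t => f (tcons ((x - c 0)%R, t))))//; last first.
  exact: (measurableT_comp mft (pair1_measurable _)).
apply: eq_integral => t _; congr f.
apply: eq_from_tnth => i; rewrite tnth_mktuple.
case: (unliftP ord0 i) => [j ->|->].
  by rewrite !tnthS tnth_mktuple.
by rewrite !tnth0.
Qed.

Lemma ge0_integral_lebesgue_rV_shift (R : realType) (n : nat) (c : 'rV[R]_n)
    (f : 'rV[R]_n -> \bar R) :
  measurable_fun setT f -> (forall x, 0 <= f x) ->
  \int[@lebesgue_rV R n]_x f (x - c)%R = \int[@lebesgue_rV R n]_x f x.
Proof.
move=> mf f0.
have mrV : measurable_fun setT (@rV_of_tuple R n).
  apply: measurable_rVP => i.
  rewrite (_ : (fun _ => _) = (fun t => tnth t i)); first exact: measurable_tnth.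
  by apply/funext => t; rewrite mxE.
have msh : measurable_fun setT (fun x : 'rV[R]_n => x - c)%R.
  apply: measurable_rVP => i.
  rewrite (_ : (fun _ => _) = (fun x : 'rV[R]_n => x ord0 i - c ord0 i)%R).
    by apply: measurable_funB => //; exact: measurable_coord.
  by apply/funext => x; rewrite !mxE.
rewrite [LHS](ge0_integral_pushforward mrV)//; last exact: measurableT_comp mf msh.
rewrite [RHS](ge0_integral_pushforward mrV)//.
(* The coordinates of [c], extended by zero to all indices. *)
pose a k : R := if insub k is Some i then c ord0 i else 0%R.
rewrite -[RHS](ge0_integral_tuple_measure_shift a); last 2 first.
- exact: measurableT_comp mf mrV.
- by move=> t; exact: f0.
apply: eq_integral => t _ /=; congr f; apply/rowP => i.
by rewrite !mxE tnth_mktuple /a valK.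
Qed.

Local Notation borel U := (g_sigma_algebraType (@open U)).

(** * Information states and the transition density restricted to safe previous states *)

Section dynamic_programming.
Context (R : realType) (n : nat) (Q : finType) (U : pseudoPMetricType R).
Variable H : poshs n Q U.

Notation leb := (@lebesgue_rV R n).
Notation obs := ('rV[R]_n * Q)%type.
Notation istate := (istate R n Q).

(* [Sigma H] without the finiteness of the mass: unlike [Sigma H], which [Top]
   leaves for exceptional observations, this class is stable under [Top]. *)
Definition density (sigma : istate) : Prop :=
  [/\ forall s, 0 <= sigma s,
      forall q, measurable_fun setT (fun x => sigma (x, q)) &
      forall x q, ~ X H x -> sigma (x, q) = 0].

Lemma Sigma_density (sigma : istate) : Sigma H sigma -> density sigma.
Proof. by case. Qed.

Lemma density_sigma0 : density (sigma0 H).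
Proof.
split=> [s|q|x q Xx]; rewrite /sigma0.
- by rewrite lee_fin; exact: rho_ge0.
- by apply/measurable_EFinP; exact: rho_measurable.
- by rewrite rho_supp.
Qed.

Lemma mass_sigma0 : mass (sigma0 H) = 1.
Proof. exact: (rho_mass H). Qed.

(** The new state is [(p.1, q)] and the previous one [(p.2, q')]. Since [K] lies in [X], the
    indicator hides the values of [tau] at previous states off [X], about which nothing is
    assumed. *)
Definition safe_kernel (u : U) (q q' : Q) (p : 'rV[R]_n * 'rV[R]_n) : R :=
  (\1_(K H) (p.2, q') * tau H p.1 q p.2 q' u)%R.

Lemma safe_kernel_ge0 u q q' p : (0 <= safe_kernel u q q' p)%R.
Proof.
rewrite /safe_kernel indicE; case: (boolP (_ \in _)) => [/set_mem Kp|_]; last first.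
  by rewrite mul0r.
rewrite mul1r.
by rewrite tau_ge0//; exact: K_sub Kp.
Qed.

Lemma safe_kernel_supp u q q' p : ~ X H p.1 -> safe_kernel u q q' p = 0%R.
Proof.
move=> Xp; rewrite /safe_kernel indicE.
case: (boolP (_ \in _)) => [/set_mem Kp|_]; last by rewrite mul0r.
by rewrite tau_supp ?mulr0//; exact: K_sub Kp.
Qed.

Lemma measurable_indic_K q :
  measurable_fun setT (fun x : 'rV[R]_n => \1_(K H) (x, q) : R).
Proof.
rewrite (_ : (fun _ => _) = \1_[set x | K H (x, q)]); last by apply/funext.
by apply: measurable_indic; exact: K_measurable.
Qed.

Lemma measurable_safe_kernel u q q' : measurable_fun setT (safe_kernel u q q').
Proof.
pose D : set ('rV[R]_n * 'rV[R]_n) := setT `*` X H.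
have mD : measurable D by apply: measurableX => //; exact: X_measurable.
have mt : measurable_fun D (fun p => tau H p.1 q p.2 q' u).
  pose j (p : 'rV[R]_n * 'rV[R]_n) : 'rV[R]_n * ('rV[R]_n * borel U) :=
    (p.1, (p.2, u)).
  have mj : measurable_fun D j.
    apply: measurable_funTS; apply: measurable_fun_pair => //.
    by apply: measurable_fun_pair => //; exact: measurable_cst.
  apply: (measurable_comp _ _ (tau_measurable (p := H) q q') mj).
  - apply: measurableX => //; apply: measurableX => //; exact: X_measurable.
  - by move=> _ [p [_ Xp] <-].
(* Measurability of [tau] is known only for previous states in [X]; under the indicator of [K],
   [tau] may be cut off outside [D]. *)
rewrite (_ : safe_kernel u q q' = fun p =>
    (\1_(K H) (p.2, q') * ((fun p => tau H p.1 q p.2 q' u) \_ D) p)%R); last first.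
  apply/funext => p; rewrite /safe_kernel patchE.
  case: ifPn => // /negP; rewrite inE => Dp.
  rewrite indicE; case: (boolP (_ \in _)) => [/set_mem Kp|_]; last by rewrite !mul0r.
  by exfalso; apply: Dp; split => //; exact: K_sub Kp.
apply: measurable_funM; last exact/(measurable_restrictT _ mD).
exact: (measurableT_comp (measurable_indic_K q') measurable_snd).
Qed.

(** From a safe state, [tau] integrates over the new continuous state to [Tq], because [Tx] is a
    probability kernel, and [Tq] sums to one over the new mode. *)
Lemma integral_safe_kernel u q' x' :
  \sum_(q : Q) \int[leb]_x (safe_kernel u q q' (x, x'))%:E = (\1_(K H) (x', q'))%:E.
Proof.
rewrite /safe_kernel/= indicE; case: (boolP (_ \in _)) => [/set_mem Kx|_]; last first.
  rewrite big1// => q _; apply: integral0_eq => x _.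
  by rewrite mul0r.
have Xx := K_sub Kx.
under eq_bigr => q _.
  under eq_integral do rewrite mul1r.
  rewrite tau_density// prob_kernel mul1e.
  over.
by rewrite sumEFin Tq_sum1.
Qed.

(** Joint continuity within [X * U] gives continuity within [X] at fixed [u], so preimages of open
    sets are traces on [X] of open sets. *)
Lemma measurable_h u : measurable_fun (X H) (h H ^~ u).
Proof.
apply: (@measurability _ _ _ _ _ _ (@open 'rV[R]_n)) => // _ [A oA <-].
have ch : {within X H, continuous (h H ^~ u)}.
  apply/subspace_continuousP => x Xx.
  have /subspace_continuousP/(_ (x, u) (conj Xx I)) hxu := @h_continuous _ _ _ _ H.
  move=> W /hxu [[A1 A2] /= [nA1 nA2] AW].
  apply: filterS nA1 => y A1y Xy; apply: (AW (y, u)) => //; split => //=.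
  exact: nbhs_singleton nA2.
have /continuousP/(_ A oA)/open_subspaceP[V oV VE] := ch.
rewrite setIC -VE; apply: measurableI; last exact: X_measurable.
exact: rV_open_measurable.
Qed.

(** * One step of the information state and its expected mass *)

Definition propagate (u : U) (sigma : istate) : istate := fun s =>
  \sum_(q' : Q) \int[leb]_x' ((safe_kernel u s.2 q' (s.1, x'))%:E * sigma (x', q')).

Section one_step.
Variables (u : U) (sigma : istate).
Hypothesis dsigma : density sigma.

Let sigma_ge0 s : 0 <= sigma s. Proof. by case: dsigma. Qed.

Let msigma q : measurable_fun setT (fun x => sigma (x, q)).
Proof. by case: dsigma. Qed.

Let ks_ge0 q q' x x' : 0 <= (safe_kernel u q q' (x, x'))%:E * sigma (x', q').
Proof. by rewrite mule_ge0// lee_fin safe_kernel_ge0. Qed.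

Let mks q q' : measurable_fun setT (fun p : 'rV[R]_n * 'rV[R]_n =>
  (safe_kernel u q q' p)%:E * sigma (p.2, q')).
Proof.
apply: emeasurable_funM; last exact: (measurableT_comp (msigma q') measurable_snd).
by apply/measurable_EFinP; exact: measurable_safe_kernel.
Qed.

Let mks_int q q' : measurable_fun setT (fun x =>
  \int[leb]_x' ((safe_kernel u q q' (x, x'))%:E * sigma (x', q'))).
Proof.
by apply: (measurable_fun_fubini_tonelli_F _ (mks q q')) => -[x x']; exact: ks_ge0.
Qed.

Lemma density_propagate : density (propagate u sigma).
Proof.
split=> [s|q|x q Xx]; rewrite /propagate/=.
- by apply: sume_ge0 => q' _; apply: integral_ge0 => x' _; exact: ks_ge0.
- exact: emeasurable_sum.
- rewrite big1// => q' _; apply: integral0_eq => x' _.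
  by rewrite safe_kernel_supp// mul0e.
Qed.

(** Tonelli lets the new state be integrated out first, which by [integral_safe_kernel] leaves the
    indicator of [K]. *)
Lemma mass_propagate : mass (propagate u sigma) = safe_mass H sigma.
Proof.
transitivity (\sum_(q : Q) \sum_(q' : Q) \int[leb]_x'
    (sigma (x', q') * \int[leb]_x (safe_kernel u q q' (x, x'))%:E)).
  rewrite /mass; apply: eq_bigr => q _; rewrite ge0_integral_sum; first last.
  - by move=> q' x _; apply: integral_ge0 => x' _; exact: ks_ge0.
  - by move=> q'; exact: mks_int.
  - exact: measurableT.
  apply: eq_bigr => q' _.
  rewrite (fubini_tonelli (fun p => (safe_kernel u q q' p)%:E * sigma (p.2, q')))//;
    last by case=> x x'; exact: ks_ge0.
  apply: eq_integral => x' _ /=.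
  under eq_integral do rewrite muleC.
  rewrite ge0_integralZl//.
  - apply/measurable_EFinP.
    exact: (measurableT_comp (measurable_safe_kernel u q q') (pair2_measurable x')).
  - by move=> x _; rewrite lee_fin safe_kernel_ge0.
rewrite exchange_big/=; apply: eq_bigr => q' _.
rewrite -ge0_integral_sum//; last 2 first.
- move=> q; apply: emeasurable_funM => //.
  apply: (measurable_fun_fubini_tonelli_G (fun p => (safe_kernel u q q' p)%:E)).
    by apply/measurable_EFinP; exact: measurable_safe_kernel.
  by move=> p; rewrite lee_fin safe_kernel_ge0.
- move=> q x' _; rewrite mule_ge0//; apply: integral_ge0 => x _.
  by rewrite lee_fin safe_kernel_ge0.
apply: eq_integral => x' _.
rewrite -ge0_sume_distrr ?integral_safe_kernel// => q _.
by apply: integral_ge0 => x _; rewrite lee_fin safe_kernel_ge0.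
Qed.

(* [h] is only controlled on [X H]; off [X H] its value is irrelevant. *)
Let hX : 'rV[R]_n -> 'rV[R]_n := (h H ^~ u) \_ (X H).

Let mhX : measurable_fun setT hX.
Proof.
apply/(measurable_restrictT (h H ^~ u) (X_measurable H : measurable _)).
exact: measurable_h.
Qed.

(** The likelihood does not involve the previous state and leaves the integral. Off [X] both sides
    vanish, so [hX] can stand for [h]. *)
Lemma TopE y s : Top H u y sigma s =
  (#|Q|%:R * Qobs H s.2 y.2 u * (phi H (y.1 - hX s.1) / phi H y.1))%:E *
  propagate u sigma s.
Proof.
case: s => x q; rewrite /Top/=.
have [Xx|Xx] := pselect (X H x); last first.
  have [_ _ /(_ _ q Xx) ->] := density_propagate; rewrite mule0.
  rewrite big1// => q' _; rewrite integral0_eq ?mule0// => x' _.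
  rewrite mulrAC -/(safe_kernel u q q' (x, x')) safe_kernel_supp//.
  by rewrite mul0r mul0e.
rewrite /propagate/= ge0_sume_distrr; last first.
  by move=> q' _; apply: integral_ge0 => x' _; exact: ks_ge0.
apply: eq_bigr => q' _; rewrite [in RHS]EFinM -muleA; congr (_ * _).
rewrite -ge0_integralZl; first last.
- by rewrite lee_fin divr_ge0// ltW// phi_gt0.
- by move=> x' _; exact: ks_ge0.
- exact: (measurableT_comp (mks q q') (pair1_measurable x)).
- exact: measurableT.
apply: eq_integral => x' _; rewrite muleA -EFinM; congr (_%:E * _).
by rewrite /safe_kernel /hX patchE mem_set//= mulrAC mulrC.
Qed.

Let Qobs_ge0 q m : (0 <= Qobs H q m u)%R.
Proof. by rewrite ltW// Qobs_gt0. Qed.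

Let phi_ge0 y : (0 <= phi H y)%R.
Proof. by rewrite ltW// phi_gt0. Qed.

Let mphihX : measurable_fun setT
  (fun p : 'rV[R]_n * 'rV[R]_n => phi H (p.1 - hX p.2)).
Proof.
apply: (measurableT_comp (phi_measurable H)); apply: measurable_rVP => i.
rewrite (_ : (fun _ => _) = (fun p : 'rV[R]_n * 'rV[R]_n =>
    p.1 ord0 i - hX p.2 ord0 i)%R); last by apply/funext => p; rewrite !mxE.
apply: measurable_funB.
  exact: (measurableT_comp (measurable_coord i) measurable_fst).
exact: (measurableT_comp (measurable_coord i) (measurableT_comp mhX measurable_snd)).
Qed.

Lemma density_Top y : density (Top H u y sigma).
Proof.
have [P0 mP PX] := density_propagate.
rewrite (_ : Top H u y sigma = fun s => (#|Q|%:R * Qobs H s.2 y.2 u *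
  (phi H (y.1 - hX s.1) / phi H y.1))%:E * propagate u sigma s); last first.
  by apply/funext => s; exact: TopE.
split=> [s|q|x q Xx] /=.
- by rewrite mule_ge0// lee_fin mulr_ge0// ?divr_ge0// mulr_ge0.
- apply: emeasurable_funM => //; apply/measurable_EFinP.
  apply: measurable_funM => //; apply: measurable_funM => //.
  exact: (measurableT_comp mphihX (pair1_measurable y.1)).
- by rewrite PX// mule0.
Qed.

(** The unnormalized joint density of the observation [(p.1, m)] and the new state [(p.2, q)] in the
    original model, that is, with the change of measure undone. *)
Let g (m q : Q) (p : 'rV[R]_n * 'rV[R]_n) : \bar R :=
  (Qobs H q m u * phi H (p.1 - hX p.2))%:E * propagate u sigma (p.2, q).

Let g_ge0 m q p : 0 <= g m q p.
Proof.
by have [P0 _ _] := density_propagate; rewrite mule_ge0// lee_fin mulr_ge0.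
Qed.

Let mg m q : measurable_fun setT (g m q).
Proof.
have [_ mP _] := density_propagate.
apply: emeasurable_funM; last exact: (measurableT_comp (mP q) measurable_snd).
by apply/measurable_EFinP; apply: measurable_funM.
Qed.

Let mass_Top y m :
  mass (Top H u (y, m) sigma) * (#|Q|%:R^-1 * phi H y)%:E =
  \sum_(q : Q) \int[leb]_x g m q (y, x).
Proof.
have [T0 mT _] := density_Top (y, m).
have w0 : (0 <= #|Q|%:R^-1 * phi H y)%R by rewrite mulr_ge0.
rewrite /mass ge0_sume_distrl; last by move=> q _; exact: integral_ge0.
apply: eq_bigr => q _; rewrite -ge0_integralZr//.
apply: eq_integral => x _; rewrite TopE/= muleAC -EFinM; congr (_%:E * _).
(* The summation index [q] itself witnesses that [Q] is nonempty. *)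
have Q0 : (#|Q|%:R != 0 :> R)%R by rewrite pnatr_eq0 -lt0n; apply/card_gt0P; exists q.
have /lt0r_neq0 p0 := phi_gt0 H y.
by rewrite /=; field; rewrite Q0.
Qed.

Lemma measurable_mass_Top m : measurable_fun setT (fun y =>
  mass (Top H u (y, m) sigma) * (#|Q|%:R^-1 * phi H y)%:E).
Proof.
under eq_fun do rewrite mass_Top.
apply: emeasurable_sum => q.
exact: (measurable_fun_fubini_tonelli_F _ (mg m q)).
Qed.

Lemma Eobs_mass_Top : Eobs H (fun y => mass (Top H u y sigma)) = safe_mass H sigma.
Proof.
have [P0 mP _] := density_propagate.
rewrite -mass_propagate /Eobs.
transitivity (\sum_(m : Q) \sum_(q : Q) \int[leb]_x
    ((Qobs H q m u)%:E * propagate u sigma (x, q))).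
  apply: eq_bigr => m _.
  under eq_integral do rewrite mass_Top.
  rewrite ge0_integral_sum//; last 2 first.
  - by move=> q; exact: (measurable_fun_fubini_tonelli_F _ (mg m q)).
  - by move=> q y _; exact: integral_ge0.
  apply: eq_bigr => q _.
  rewrite (fubini_tonelli (g m q))//; apply: eq_integral => x _; rewrite /g/=.
  under eq_integral do rewrite mulrC EFinM -muleA.
  have mphi : measurable_fun setT (fun y => (phi H y)%:E).
    by apply/measurable_EFinP; exact: phi_measurable.
  rewrite ge0_integralZr; first last.
  - by rewrite mule_ge0// lee_fin.
  - by move=> y _; rewrite lee_fin.
  - apply/measurable_EFinP.
    exact: (measurableT_comp mphihX (pair2_measurable x)).
  - exact: measurableT.
  (* At a fixed new state [x] the observation density is [phi] shifted by [hX x], hence of mass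
     one. *)
  rewrite (ge0_integral_lebesgue_rV_shift (hX x) mphi)//.
  by rewrite phi_mass mul1e.
rewrite exchange_big/=; apply: eq_bigr => q _.
rewrite -ge0_integral_sum//; last 2 first.
- by move=> m; exact: emeasurable_funM.
- by move=> m x _; rewrite mule_ge0// lee_fin.
apply: eq_integral => x _; rewrite -ge0_sume_distrl; last first.
  by move=> m _; rewrite lee_fin.
by rewrite sumEFin Qobs_sum1 mul1e.
Qed.

End one_step.

(** * Monotonicity of the expectation and bounds on the value functions *)

Lemma le_Eobs (V W : obs -> \bar R) :
  (forall y, 0 <= V y) -> (forall y, V y <= W y) -> Eobs H V <= Eobs H W.
Proof.
move=> V0 VW; have w0 y : 0 <= (#|Q|%:R^-1 * phi H y)%:E.
  by rewrite lee_fin mulr_ge0// ltW// phi_gt0.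
apply: lee_sum => q _; apply: ge0_le_lower_integral => y; first exact: mule_ge0.
exact: lee_wpmul2r.
Qed.

Lemma Eobs_ge0 (V : obs -> \bar R) : (forall y, 0 <= V y) -> 0 <= Eobs H V.
Proof.
move=> V0; apply: sume_ge0 => q _; apply: integral_ge0 => y _.
by rewrite mule_ge0// lee_fin mulr_ge0// ltW// phi_gt0.
Qed.

Lemma mass_ge0 (sigma : istate) : density sigma -> 0 <= mass sigma.
Proof. by case=> s0 _ _; apply: sume_ge0 => q _; exact: integral_ge0. Qed.

Lemma safe_mass_ge0 (sigma : istate) : density sigma -> 0 <= safe_mass H sigma.
Proof.
case=> s0 _ _; apply: sume_ge0 => q _; apply: integral_ge0 => x _.
by rewrite mule_ge0// lee_fin.
Qed.

Lemma safe_mass_le_mass (sigma : istate) :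
  density sigma -> safe_mass H sigma <= mass sigma.
Proof.
case=> s0 _ _; apply: lee_sum => q _; apply: ge0_le_lower_integral => x.
  by rewrite mule_ge0// lee_fin.
by rewrite -[leRHS]mule1 lee_wpmul2l// lee_fin indicE lern1 leq_b1.
Qed.

(** [V] and [W] are arbitrary, but the error term is measurable, so [ge0_lower_integral_leD]
    applies; [Eobs_mass_Top] evaluates its mean. *)
Lemma Eobs_leD (u : U) (sigma : istate) (c : R) (V W : obs -> \bar R) :
  density sigma -> (0 <= c)%R -> (forall y, 0 <= V y) -> (forall y, 0 <= W y) ->
  (forall y, V y <= W y + c%:E * mass (Top H u y sigma)) ->
  Eobs H V <= Eobs H W + c%:E * safe_mass H sigma.
Proof.
move=> ds c0 V0 W0 VW.
have w0 y : 0 <= (#|Q|%:R^-1 * phi H y)%:E.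
  by rewrite lee_fin mulr_ge0// ltW// phi_gt0.
have m0 y : 0 <= mass (Top H u y sigma) by exact/mass_ge0/density_Top.
rewrite -(Eobs_mass_Top u ds) /Eobs.
rewrite ge0_sume_distrr; last first.
  by move=> q _; apply: integral_ge0 => y _; exact: mule_ge0.
rewrite -big_split/=; apply: lee_sum => q _.
rewrite -ge0_integralZl; first last.
- by rewrite lee_fin.
- by move=> y _; exact: mule_ge0.
- exact: measurable_mass_Top.
- exact: measurableT.
apply: ge0_lower_integral_leD => [y|y|y||y].
- exact: mule_ge0.
- exact: mule_ge0.
- by rewrite mule_ge0// ?lee_fin// mule_ge0.
- by apply: emeasurable_funM => //; exact: measurable_mass_Top.
- rewrite muleA -ge0_muleDl//; last by rewrite mule_ge0// lee_fin.
  exact: lee_wpmul2r.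
Qed.

Lemma Vtogo_ge0 j (sigma : istate) : density sigma -> 0 <= Vtogo H j sigma.
Proof.
elim: j sigma => [|j IH] sigma ds; first exact: safe_mass_ge0.
(* An empty supremum would be [-oo]; [point] supplies a control. *)
apply: (@le_trans _ _ (Eobs H (fun y => Vtogo H j (Top H point y sigma)))).
  by apply: Eobs_ge0 => y; exact/IH/density_Top.
by apply: ereal_sup_ubound; exists point.
Qed.

Lemma Vtogo_le_mass j (sigma : istate) : density sigma -> Vtogo H j sigma <= mass sigma.
Proof.
elim: j sigma => [|j IH] sigma ds; first exact: safe_mass_le_mass.
apply: ge_ereal_sup => _ [u _ <-].
apply: le_trans (safe_mass_le_mass ds); rewrite -(Eobs_mass_Top u ds).
apply: le_Eobs => y; first exact/Vtogo_ge0/density_Top.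
exact/IH/density_Top.
Qed.

(** * Policies compared with the value functions *)

(** The cost with a free initial state and a list as policy, which permits induction on the
    remaining stages. *)
Definition gain (pi : seq (istate -> U)) (sigma : istate) : \bar R :=
  Edag H (size pi) (fun ys => safe_mass H (run H pi ys sigma)).

Lemma gain_cons mu pi (sigma : istate) :
  gain (mu :: pi) sigma = Eobs H (fun y => gain pi (Top H (mu sigma) y sigma)).
Proof. by []. Qed.

Lemma cost_gain N (pi : policy n Q U N) : cost H pi = gain pi (sigma0 H).
Proof. by rewrite /cost /gain size_tuple. Qed.

Lemma gain_ge0 pi (sigma : istate) : density sigma -> 0 <= gain pi sigma.
Proof.
elim: pi sigma => [|mu pi IH] sigma ds; first exact: safe_mass_ge0.
by apply: Eobs_ge0 => y; exact/IH/density_Top.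
Qed.

Lemma gain_le_Vtogo pi (sigma : istate) :
  density sigma -> gain pi sigma <= Vtogo H (size pi) sigma.
Proof.
elim: pi sigma => [//|mu pi IH] sigma ds; rewrite gain_cons.
apply: le_trans (ereal_sup_ubound _); last by exists (mu sigma).
apply: le_Eobs => y; first exact/gain_ge0/density_Top.
exact/IH/density_Top.
Qed.

(* The slack is proportional to the mass, so that the errors made at the next
   state are averaged by [Eobs_mass_Top] and nothing is asked of states of
   infinite mass. *)
Definition greedy_choice (e : R) (j : nat) (mu : istate -> U) : Prop :=
  forall sigma, density sigma -> Vtogo H j.+1 sigma <=
    Eobs H (fun y => Vtogo H j (Top H (mu sigma) y sigma)) + e%:E * mass sigma.

Lemma greedy_gain e (mu0 : istate -> U) pi (sigma : istate) : (0 <= e)%R ->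
  (forall k, (k < size pi)%N -> greedy_choice e (size pi - k.+1) (nth mu0 pi k)) ->
  density sigma ->
  Vtogo H (size pi) sigma <= gain pi sigma + ((size pi)%:R * e)%:E * mass sigma.
Proof.
move=> e0; elim: pi sigma => [|mu pi IH] sigma opt ds.
  by rewrite mul0r mul0e adde0.
have /(_ _ ds) := opt 0%N isT; rewrite /= subSS subn0 => /le_trans; apply.
rewrite gain_cons.
have pe0 : (0 <= (size pi)%:R * e)%R by rewrite mulr_ge0.
(* One share [e * mass sigma] pays for the first choice; the others are left for the later ones. *)
rewrite -natr1 mulrDl mul1r EFinD ge0_muleDl ?lee_fin// addeA leeD2r//.
apply: (@le_trans _ _ (Eobs H (fun y => gain pi (Top H (mu sigma) y sigma)) +
    ((size pi)%:R * e)%:E * safe_mass H sigma)).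
  apply: Eobs_leD => // y.
  - exact/Vtogo_ge0/density_Top.
  - exact/gain_ge0/density_Top.
  - by apply: IH; [move=> k kpi; exact: (opt k.+1)|exact: density_Top].
by rewrite leeD2l// lee_wpmul2l ?lee_fin// safe_mass_le_mass.
Qed.

(** Zero mass forces the value to be zero, and infinite mass makes the slack infinite, so any
    control will do. Otherwise the supremum is finite and the slack positive, so some control comes
    that close. *)
Lemma greedy_choice_exists (e : R) j :
  (0 < e)%R -> exists mu : istate -> U, greedy_choice e j mu.
Proof.
move=> e0.
suff /choice[mu hmu] : forall sigma, exists u, density sigma ->
    Vtogo H j.+1 sigma <=
    Eobs H (fun y => Vtogo H j (Top H u y sigma)) + e%:E * mass sigma.
  by exists mu => sigma; exact: hmu.
move=> sigma; have [ds|] := pselect (density sigma); last by exists point.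
have E0 u : 0 <= Eobs H (fun y => Vtogo H j (Top H u y sigma)).
  by apply: Eobs_ge0 => y; exact/Vtogo_ge0/density_Top.
have V0 := Vtogo_ge0 j.+1 ds; have VM := Vtogo_le_mass j.+1 ds.
have [m0|] := eqVneq (mass sigma) 0.
  exists point => _; apply: (le_trans VM); rewrite m0 mule0 adde0.
  exact: E0.
case M : (mass sigma) (mass_ge0 ds) => [r| |]// r0 rn0; last first.
  exists point => _; rewrite gt0_muley ?lte_fin// addey ?leey//.
  by rewrite gt_eqF// (lt_le_trans _ (E0 _)).
have rpos : (0 < r)%R by rewrite -lte_fin lt_def rn0.
have Vfin : Vtogo H j.+1 sigma \is a fin_num.
  by rewrite ge0_fin_numE// (le_lt_trans VM)// M ltry.
have [_ [u _ <-] lt_u] := ub_ereal_sup_adherent (mulr_gt0 e0 rpos) Vfin.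
by exists u => _; rewrite -EFinM -leeBlDr// ltW.
Qed.

(** An argsup policy is constrained only on [Sigma]; a density outside it has infinite mass, where a
    positive [e] makes the bound trivial. *)
Lemma argsup_greedy (e : R) N (pi : policy n Q U N) (k : 'I_N) : (0 < e)%R ->
  argsup_policy H pi -> greedy_choice e (N - k.+1) (tnth pi k).
Proof.
move=> e0 opt sigma ds.
have E0 : 0 <= Eobs H (fun y => Vtogo H (N - k.+1) (Top H (tnth pi k sigma) y sigma)).
  by apply: Eobs_ge0 => y; exact/Vtogo_ge0/density_Top.
have [fin|] := boolP (mass sigma < +oo); last first.
  rewrite ltey negbK => /eqP ->.
  by rewrite gt0_muley ?lte_fin// addey ?leey// gt_eqF// (lt_le_trans _ E0).
have Ss : Sigma H sigma by case: ds.
have /= <- := opt k sigma Ss.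
by rewrite leeDl// mule_ge0 ?mass_ge0// lee_fin ltW.
Qed.

(** * Optimality, by letting the slack tend to zero *)

Lemma greedy_cost (e : R) N (pi : policy n Q U N) : (0 <= e)%R ->
  (forall k : 'I_N, greedy_choice e (N - k.+1) (tnth pi k)) ->
  Vstar H N 0 (sigma0 H) <= cost H pi + (N%:R * e)%:E.
Proof.
move=> e0 opt; rewrite /Vstar subn0 cost_gain.
have := @greedy_gain e (fun=> point) pi (sigma0 H) e0 _ density_sigma0.
rewrite size_tuple mass_sigma0 mule1; apply=> k kN.
by have := opt (Ordinal kN); rewrite (tnth_nth (fun=> point)).
Qed.

Lemma cost_le_Vstar N (pi : policy n Q U N) : cost H pi <= Vstar H N 0 (sigma0 H).
Proof.
rewrite cost_gain /Vstar subn0 -[X in Vtogo H X](size_tuple pi).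
exact: gain_le_Vtogo density_sigma0.
Qed.

(** The policy may vary with [e], as for the supremum formula, or stay fixed, as for an argsup
    policy. *)
Lemma Vstar_le_greedy N (x : \bar R) :
  (forall e, (0 < e)%R -> exists2 pi : policy n Q U N, cost H pi <= x &
     forall k : 'I_N, greedy_choice e (N - k.+1) (tnth pi k)) ->
  Vstar H N 0 (sigma0 H) <= x.
Proof.
move=> ex; apply/lee_addgt0Pr => e e0.
(* [N] stages then lose at most [e] in total; [N.+1] also covers the horizon zero. *)
have d0 : (0 < e / N.+1%:R)%R by rewrite divr_gt0.
have [pi pix opt] := ex _ d0.
apply: (le_trans (greedy_cost (ltW d0) opt)); apply: leeD => //.
by rewrite lee_fin mulrCA ger_pMr// ler_pdivrMr// mul1r ler_nat.
Qed.

Lemma Vstar_sup_cost N :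
  Vstar H N 0 (sigma0 H) = ereal_sup [set cost H pi | pi in [set: policy n Q U N]].
Proof.
apply/eqP; rewrite eq_le; apply/andP; split; last first.
  by apply: ge_ereal_sup => _ [pi _ <-]; exact: cost_le_Vstar.
apply: Vstar_le_greedy => e e0.
have /choice[mu hmu] := fun j => @greedy_choice_exists e j e0.
(* [mu] is indexed by the number of stages left after the current one. *)
exists [tuple mu (N - k.+1)%N | k < N] => [|k]; last by rewrite tnth_mktuple.
by apply: ereal_sup_ubound; exists [tuple mu (N - k.+1)%N | k < N].
Qed.

Lemma argsup_cost N (pi : policy n Q U N) :
  argsup_policy H pi -> cost H pi = Vstar H N 0 (sigma0 H).
Proof.
move=> opt; apply/eqP; rewrite eq_le cost_le_Vstar/=.
by apply: Vstar_le_greedy => e e0; exists pi => // k; exact: argsup_greedy.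
Qed.

End dynamic_programming.

Theorem theorem7 (R : realType) (n : nat) (Q : finType)
    (U : pseudoPMetricType R) (Ucompact : compact [set: U])
    (Uhausdorff : hausdorff_space U) (H : poshs n Q U) (N : nat) :
  [/\ Vstar H N 0 (sigma0 H) = ereal_sup [set cost H pi | pi in [set: policy n Q U N]],
      forall (k : nat) (sigma : istate R n Q), (k <= N)%N -> Sigma H sigma ->
        0 <= Vstar H N k sigma /\ Vstar H N k sigma < +oo,
      forall (k : nat) (sigma : istate R n Q), (k <= N)%N -> Sigma H sigma ->
        mass sigma = 1 -> 0 <= Vstar H N k sigma /\ Vstar H N k sigma <= 1 &
      forall pi : policy n Q U N, argsup_policy H pi ->
        cost H pi = ereal_sup [set cost H pi' | pi' in [set: policy n Q U N]]].
Proof.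
split=> [|k sigma _ Ss|k sigma _ Ss m1|pi opt].
- exact: Vstar_sup_cost.
- have ds := Sigma_density Ss; split; first exact: Vtogo_ge0.
  by apply: le_lt_trans (Vtogo_le_mass _ ds) _; case: Ss.
- have ds := Sigma_density Ss; split; first exact: Vtogo_ge0.
  by rewrite -m1; exact: Vtogo_le_mass.
- by rewrite argsup_cost// Vstar_sup_cost.
Qed.
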